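(* Let $a=(a_i)_{i\in\mathbb Z}$ be a sequence of integers $a_i\ge2$, let $a^*_i=a_{-i}$, and write $N=N_a$, $\Omega=\Omega_a$, $N^*=N_{a^*}$, $\Omega^*=\Omega_{a^*}$. Regard $N$ as a closed subgroup of $\mathbb R\times\Omega$ and $N^*$ as a closed subgroup of $\mathbb R\times\Omega^*$ via the diagonal embeddings $q\mapsto(q,q)$, and let $N^\perp\subset\widehat{\mathbb R\times\Omega}$ be the annihilator of $N$. Then there are isomorphisms (of topological groups) $$(\mathbb R\times\Omega^* )/N^*\ \xrightarrow{\cong}\ \widehat{\mathbb R\times\Omega}/N^\perp\ \xrightarrow{\cong}\ \widehat N,$$ and the (composite) isomorphism $\omega\colon(\mathbb R\times\Omega^* )/N^*\to\widehat N$ is given by $$\omega\bigl((v,y)+N^*\bigr)(q)=\langle(q,q),(v,y)\rangle\qquad\text{for }(v,y)\in\mathbb R\times\Omega^*,\ q\in N.$$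
   Context: For a sequence $a=(a_i)_{i\in\mathbb Z}$ of integers $a_i\ge2$, the $a$-adic numbers $\Omega_a$ are the sequences $x=(x_i)_{i\in\mathbb Z}$ with $x_i\in\{0,\dots,a_i-1\}$ and $x_i=0$ for all $i<j$ for some $j\in\mathbb Z$, under addition with carry ($z=x+y$ is determined by $x_i+y_i+c_i=z_i+a_ic_{i+1}$, with carries $c_i\in\{0,1\}$ and $c_i=0$ for $i$ small), with the group topology having the subgroups $\{x: x_i=0\text{ for }i<j\}$, $j\in\mathbb Z$, as neighbourhood basis at $0$. Let $N_a=\{\frac{j}{a_{-1}\cdots a_{-k}}: j\in\mathbb Z,\ k\ge1\}\subset\mathbb Q$ (discrete), embedded as a dense subgroup of $\Omega_a$ by the homomorphism sending $\frac1{a_{-1}\cdots a_{-k}}$ to the sequence with entry $1$ at position $-k$ and $0$ elsewhere. For $x\in\Omega_a$ with $x_i=0$ for $i<-k$, the truncation $x^{(j)}$ ($j\ge1$) is treated as the rational number $\frac{x_{-k}}{a_{-1}\cdots a_{-k}}+\dots+\frac{x_{-1}}{a_{-1}}+x_0+a_0x_1+\dots+a_0\cdots a_{j-1}x_j\in N_a$; similarly for $y\in\Omega_{a^*}$ with $a^*$ in place of $a$. The pairing $(\mathbb R\times\Omega)\times(\mathbb R\times\Omega^* )\to\mathbb T$ is $$\langle(u,x),(v,y)\rangle=e^{-2\pi iuv/a_0}\lim_{j\to\infty}e^{2\pi ix^{(j)}y^{(j)}/a_0},$$ where the sequence in the limit is eventually constant. $\widehat{\ \cdot\ }$ denotes the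 Pontryagin dual. *)

(* Defs.v *)
From HB Require Import structures.
From mathcomp Require Import all_boot all_order all_algebra.
From mathcomp Require Import complex ring lra zify.
From mathcomp Require Import all_classical all_reals all_analysis.

Set Implicit Arguments.
Unset Strict Implicit.
Unset Printing Implicit Defensive.

Import Order.TTheory GRing.Theory Num.Theory.
Import numFieldNormedType.Exports.

Local Open Scope classical_set_scope.
Local Open Scope ring_scope.
Local Open Scope complex_scope.

Record radix := Radix {
  radix_val :> int -> nat;
  radix_ge2 : forall i, (2 <= radix_val i)%N }.

Definition radix_dual (a : radix) : radix :=
  @Radix (fun i => a (- i)) (fun i => radix_ge2 a (- i)).

Lemma radix_gt0 (a : radix) i : (0 < a i)%N.
Proof. exact: ltn_trans (radix_ge2 a i). Qed.

Definition is_adic (a : radix) (x : int -> nat) : Prop :=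
  (forall i, (x i < a i)%N) /\ (exists j : int, forall i, i < j -> x i = 0%N).

Record adic (a : radix) := Adic {
  digit :> int -> nat;
  digitP : `[< is_adic a digit >] }.

HB.instance Definition _ a := [isSub for @digit a].
HB.instance Definition _ a := [Choice of adic a by <:].

Section AdicDigits.
Variable a : radix.
Implicit Types x y z : adic a.

Lemma adicE x y : digit x =1 digit y -> x = y.
Proof. by move=> /funext xy; apply: val_inj. Qed.

Lemma digit_lt x i : (x i < a i)%N.
Proof. by have /asboolP[] := digitP x. Qed.

Lemma tail_exists x : exists k : nat, `[< forall i : int, i < - k%:Z -> x i = 0%N >].
Proof.
have /asboolP[_ [j xj]] := digitP x; exists `|j|%N; apply/asboolP => i ij.
by apply: xj; lia.
Qed.

Definition tail x : nat := ex_minn (tail_exists x).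

Definition supp_ge (k : nat) (f : int -> nat) := forall i : int, i < - k%:Z -> f i = 0%N.

Lemma tailP x k : (tail x <= k)%N -> supp_ge k x.
Proof.
rewrite /tail; case: ex_minnP => m /asboolP xm _ mk i ik; apply: xm; lia.
Qed.

Lemma is_adicP k f : (forall i, (f i < a i)%N) -> supp_ge k f -> `[< is_adic a f >].
Proof. by move=> fa fk; apply/asboolP; split => //; exists (- k%:Z). Qed.

(* carry into position [n - k], for [x] and [y] vanishing below [- k] *)
Fixpoint carry_from x y (k n : nat) : nat :=
  if n is n'.+1 then
    let i := (n'%:Z - k%:Z)%R in ((x i + y i + carry_from x y k n') %/ a i)%N
  else 0%N.

Definition carry x y (i : int) : nat :=
  let k := maxn (tail x) (tail y) in
  if (i + k%:Z)%R is Posz n then carry_from x y k n else 0%N.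

Definition adic_add_digit x y (i : int) : nat :=
  ((x i + y i + carry x y i) %% a i)%N.

Lemma carry_small x y (k : nat) : (tail x <= k)%N -> (tail y <= k)%N ->
  forall i : int, i <= - k%:Z -> carry x y i = 0%N.
Proof.
move=> xk yk i ik; rewrite /carry; case E : (i + _) => [n|//].
by have -> : n = 0%N by lia.
Qed.

Lemma carryS x y i : carry x y (i + 1) = ((x i + y i + carry x y i) %/ a i)%N.
Proof.
rewrite /carry; set k := maxn _ _.
case: (ltP i (- k%:Z)) => ik.
  rewrite (@tailP x k _ i) ?(@tailP y k _ i) ?leq_maxl ?leq_maxr//.
  case E : (i + k%:Z) => [n|n]; first by lia.
  rewrite div0n; case F : (i + 1 + k%:Z) => [m|//].
  by have -> : m = 0%N by lia.
case E : (i + k%:Z) => [n|n]; last by lia.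
have -> : i + 1 + k%:Z = n.+1 by lia.
by rewrite /=; have -> : n%:Z - k%:Z = i by lia.
Qed.

Lemma carry_eq x y i :
  (x i + y i + carry x y i = adic_add_digit x y i + a i * carry x y (i + 1))%N.
Proof. by rewrite carryS /adic_add_digit [RHS]addnC mulnC -divn_eq. Qed.

Lemma carry_le1 x y i : (carry x y i <= 1)%N.
Proof.
set k := maxn (tail x) (tail y).
case: (leP i (- k%:Z)) => ik.
  by rewrite (@carry_small _ _ k) ?leq_maxl ?leq_maxr.
have : exists n : nat, i = n%:Z - k%:Z by exists (absz (i + k%:Z)); lia.
case=> n ->; elim: n => [|n IH]; first by rewrite (@carry_small _ _ k) ?leq_maxl ?leq_maxr//; lia.
have -> : n.+1%:Z - k%:Z = n%:Z - k%:Z + 1 by lia.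
rewrite carryS -ltnS ltn_divLR ?radix_gt0//.
have := digit_lt x (n%:Z - k%:Z); have := digit_lt y (n%:Z - k%:Z).
move: IH; lia.
Qed.

Lemma add_supp x y k : (tail x <= k)%N -> (tail y <= k)%N ->
  supp_ge k (adic_add_digit x y).
Proof.
move=> xk yk i ik; rewrite /adic_add_digit (@carry_small _ _ k)//; last exact: ltW.
by rewrite (tailP xk)// (tailP yk)// mod0n.
Qed.

Lemma add_is_adic x y : `[< is_adic a (adic_add_digit x y) >].
Proof.
apply: (@is_adicP (maxn (tail x) (tail y))).
  by move=> i; rewrite ltn_mod radix_gt0.
by apply: add_supp; rewrite ?leq_maxl ?leq_maxr.
Qed.

(* characterized by [carry_eq], [carry_le1] and [carry_small] *)
Definition adic_add x y : adic a := Adic (add_is_adic x y).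

Lemma zero_is_adic : `[< is_adic a (fun=> 0%N) >].
Proof. by apply: (@is_adicP 0) => // i; exact: radix_gt0. Qed.

Definition adic_zero : adic a := Adic zero_is_adic.

(* subtraction from 0: below and at the lowest nonzero digit nothing is borrowed *)
Definition borrow x (i : int) : bool := `[< exists2 j : int, j < i & x j != 0%N >].

Definition adic_opp_digit x (i : int) : nat :=
  if borrow x i then (a i - 1 - x i)%N else ((a i - x i) %% a i)%N.

Lemma borrow_small x k : supp_ge k x -> forall i : int, i <= - k%:Z -> borrow x i = false.
Proof.
move=> xk i ik; apply/negbTE/asboolPn => -[j ji].
by rewrite xk//; lia.
Qed.

Lemma opp_small x k : supp_ge k x -> supp_ge k (adic_opp_digit x).
Proof.
by move=> xk i ik; rewrite /adic_opp_digit (borrow_small xk) ?ltW// xk// subn0 modnn.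
Qed.

Lemma opp_is_adic x : `[< is_adic a (adic_opp_digit x) >].
Proof.
apply: (@is_adicP (tail x)); last exact/opp_small/tailP.
move=> i; have := digit_lt x i; rewrite /adic_opp_digit; case: ifP => _.
  by have := radix_gt0 a i; lia.
by rewrite ltn_mod radix_gt0.
Qed.

Definition adic_opp x : adic a := Adic (opp_is_adic x).

Lemma borrow_eq x i :
  (x i + adic_opp x i + borrow x i = 0 + a i * borrow x (i + 1))%N.
Proof.
rewrite /= /adic_opp_digit.
have bS : borrow x (i + 1) = borrow x i || (x i != 0%N).
  apply/asboolP/orP => [[j ji xj]|[/asboolP[j ji xj]|xi]].
  - case: (ltP j i) => ij; first by left; apply/asboolP; exists j.
    by right; have -> : i = j by lia.
  - by exists j => //; lia.
  - by exists i => //; lia.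
have := digit_lt x i; rewrite bS; case: (borrow x i) => /=; first by rewrite ?muln1 ?add0n; lia.
case: (x i =P 0%N) => [->|/eqP x0] xa /=; first by rewrite subn0 modnn muln0.
by rewrite modn_small; lia.
Qed.

End AdicDigits.

(* [weight a (- k) = 1 / (a_{-1} ... a_{-k})] and
   [weight a n = a_0 ... a_{n - 1}] *)
Definition weight (a : radix) (i : int) : rat :=
  match i with
  | Posz n => \prod_(k < n) (a k%:Z)%:R
  | Negz n => (\prod_(k < n.+1) (a (- k.+1%:Z))%:R)^-1
  end.

Lemma weight_gt0 a i : 0 < weight a i.
Proof.
case: i => n; rewrite /weight ?invr_gt0; apply: prodr_gt0 => k _;
  by rewrite ltr0n radix_gt0.
Qed.

Lemma weightS a i : weight a (i + 1) = weight a i * (a i)%:R.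
Proof.
case: i => n.
  have -> : n%:Z + 1 = n.+1 by lia.
  by rewrite /weight big_ord_recr.
have an0 : ((a (Negz n))%:R : rat) != 0 by rewrite pnatr_eq0 -lt0n radix_gt0.
case: n an0 => [|n] an0.
  by rewrite /= big_ord0 big_ord_recr big_ord0 /= mul1r mulVf.
have -> : Negz n.+1 + 1 = Negz n by lia.
rewrite /weight [in RHS]big_ord_recr /= -NegzE invfM -mulrA mulVf ?mulr1//.
Qed.

Section PartialSums.
Variable a : radix.
Implicit Types x y z : adic a.

(* the first [n] terms, starting at position [- k] *)
Definition partial_sum (f : int -> nat) (k n : nat) : rat :=
  \sum_(m < n) (f (m%:Z - k%:Z))%:R * weight a (m%:Z - k%:Z).

Lemma partial_sumS f k n : partial_sum f k n.+1 =
  partial_sum f k n + (f (n%:Z - k%:Z))%:R * weight a (n%:Z - k%:Z).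
Proof. by rewrite /partial_sum big_ord_recr. Qed.

Lemma partial_sum_add f g h (c : int -> nat) k : c (- k%:Z) = 0%N ->
  (forall i, (f i + g i + c i = h i + a i * c (i + 1)%R)%N) ->
  forall n, partial_sum h k n =
    partial_sum f k n + partial_sum g k n - (c (n%:Z - k%:Z))%:R * weight a (n%:Z - k%:Z).
Proof.
move=> c0 E; elim=> [|n IH].
  by rewrite sub0r c0 /partial_sum !big_ord0 mul0r subr0 addr0.
rewrite !partial_sumS IH; set i := n%:Z - k%:Z.
have -> : n.+1%:Z - k%:Z = i + 1 by rewrite /i; lia.
have /(congr1 (fun n => n%:R : rat)) := E i.
rewrite !natrD natrM weightS => Ei.
have -> : (h i)%:R = (f i)%:R + (g i)%:R + (c i)%:R - (a i)%:R * (c (i + 1))%:R :> rat.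
  by rewrite Ei addrK.
ring.
Qed.

Lemma partial_sum_bound x k n :
  0 <= partial_sum x k n < weight a (n%:Z - k%:Z).
Proof.
elim: n => [|n /andP[IH1 IH2]]; first by rewrite /partial_sum big_ord0 lexx weight_gt0.
rewrite partial_sumS; set i := n%:Z - k%:Z in IH2 *.
have -> : n.+1%:Z - k%:Z = i + 1 by rewrite /i; lia.
rewrite weightS addr_ge0 ?mulr_ge0 ?ler0n ?(ltW (weight_gt0 _ _))//=.
have xa : (x i)%:R + 1 <= (a i)%:R :> rat by rewrite natr1 ler_nat digit_lt.
have w0 := weight_gt0 a i.
apply: lt_le_trans (_ : weight a i + (x i)%:R * weight a i <= _); first by rewrite ltrD2r.
by rewrite -[X in X + _]mul1r -mulrDl addrC mulrC ler_wpM2l // ltW.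
Qed.

(* congruence modulo the weight of position [n - k] *)
Definition modw (k n : nat) (p q : rat) : Prop :=
  exists m : int, p - q = m%:~R * weight a (n%:Z - k%:Z).

Lemma modw_refl k n p : modw k n p p.
Proof. by exists 0; rewrite subrr mul0r. Qed.

Lemma modw_sym k n p q : modw k n p q -> modw k n q p.
Proof. by case=> m E; exists (- m); rewrite mulrNz mulNr -E opprB. Qed.

Lemma modw_trans k n q p r : modw k n p q -> modw k n q r -> modw k n p r.
Proof.
case=> m E [m' E']; exists (m + m'); rewrite rmorphD mulrDl -E -E'; ring.
Qed.

Lemma modwD k n p p' q q' : modw k n p q -> modw k n p' q' -> modw k n (p + p') (q + q').
Proof.
case=> m E [m' E']; exists (m + m'); rewrite rmorphD mulrDl -E -E'; ring.
Qed.

Lemma adic_modw_inj x y k : supp_ge k x -> supp_ge k y ->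
  (forall n, modw k n (partial_sum x k n) (partial_sum y k n)) -> x = y.
Proof.
move=> xk yk E.
have {}E n : partial_sum x k n = partial_sum y k n.
  have [m Em] := E n; have w0 := weight_gt0 a (n%:Z - k%:Z).
  have /andP[x0 xw] := partial_sum_bound x k n.
  have /andP[y0 yw] := partial_sum_bound y k n.
  suff m0 : m = 0 by move: Em; rewrite m0 mul0r => /eqP; rewrite subr_eq0 => /eqP.
  have m1 : (m%:~R : rat) < 1%:~R.
    by rewrite -(ltr_pM2r w0) -Em mul1r; lra.
  have m2 : (- 1)%:~R < (m%:~R : rat).
    by rewrite -(ltr_pM2r w0) -Em mulN1r; lra.
  by move: m1 m2; rewrite !ltr_int; lia.
apply: adicE => i; case: (ltP i (- k%:Z)) => ik; first by rewrite xk// yk.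
have -> : i = (absz (i + k%:Z))%:Z - k%:Z by lia.
move: (absz _) => n; have := E n.+1; rewrite !partial_sumS E => /addrI.
by move/(mulIf (lt0r_neq0 (weight_gt0 _ _)))/eqP; rewrite eqr_nat => /eqP.
Qed.

Lemma adic_add_modw x y k : (tail x <= k)%N -> (tail y <= k)%N ->
  forall n, modw k n (partial_sum (adic_add x y) k n) (partial_sum x k n + partial_sum y k n).
Proof.
move=> xk yk n.
exists (- (carry x y (n%:Z - k%:Z))%:Z).
rewrite (@partial_sum_add x y _ (carry x y))//; last exact: carry_eq.
  rewrite mulrNz mulNr -pmulrn; ring.
by rewrite (@carry_small _ _ _ k).
Qed.

Lemma adic_opp_modw x k : (tail x <= k)%N ->
  forall n, modw k n (partial_sum (adic_opp x) k n) (- partial_sum x k n).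
Proof.
move=> xk n; exists (borrow x (n%:Z - k%:Z) : int).
have := @partial_sum_add x (adic_opp x) (fun=> 0%N) (fun i => borrow x i) k _
  (@borrow_eq _ x) n.
rewrite (@borrow_small _ _ k)//; last exact: tailP.
have -> : partial_sum (fun=> 0%N) k n = 0 by apply: big1 => i _; rewrite mul0r.
by move=> /(_ erefl) E; rewrite opprK -pmulrn addrC; apply/eqP; rewrite -subr_eq0 -E.
Qed.

Lemma adic_addC : commutative (@adic_add a).
Proof.
move=> x y; pose k := maxn (tail x) (tail y).
have xk : (tail x <= k)%N by rewrite leq_maxl.
have yk : (tail y <= k)%N by rewrite leq_maxr.
apply: (@adic_modw_inj _ _ k); [exact: add_supp|exact: add_supp|move=> n].
apply: modw_trans (adic_add_modw xk yk n) _; rewrite addrC.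
exact/modw_sym/adic_add_modw.
Qed.

Lemma adic_addA : associative (@adic_add a).
Proof.
move=> x y z.
pose k := \max_(t <- [:: x; y; z; adic_add x y; adic_add y z]) tail t.
have tk t : t \in [:: x; y; z; adic_add x y; adic_add y z] -> (tail t <= k)%N.
  by move=> ts; rewrite /k; apply: (@leq_bigmax_seq _ _ xpredT (@tail a)).
have [xk yk zk xyk yzk] : [/\ (tail x <= k)%N, (tail y <= k)%N, (tail z <= k)%N,
    (tail (adic_add x y) <= k)%N & (tail (adic_add y z) <= k)%N].
  by split; apply: tk; rewrite !inE eqxx ?orbT.
apply: (@adic_modw_inj _ _ k); [exact: add_supp|exact: add_supp|move=> n].
apply: modw_trans (adic_add_modw xk yzk n) _.
apply: modw_trans (modwD (modw_refl _ _ _) (adic_add_modw yk zk n)) _.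
apply: modw_sym.
apply: modw_trans (adic_add_modw xyk zk n) _; rewrite addrA.
exact: modwD (adic_add_modw xk yk n) (modw_refl _ _ _).
Qed.

Lemma partial_sum0 k n : partial_sum (adic_zero a) k n = 0.
Proof. by apply: big1 => i _; rewrite mul0r. Qed.

Lemma adic_add0 : left_id (adic_zero a) (@adic_add a).
Proof.
move=> x; pose k := maxn (tail (adic_zero a)) (tail x).
have zk : (tail (adic_zero a) <= k)%N by rewrite leq_maxl.
have xk : (tail x <= k)%N by rewrite leq_maxr.
apply: (@adic_modw_inj _ _ k); [exact: add_supp|exact: tailP|move=> n].
apply: modw_trans (adic_add_modw zk xk n) _.
by rewrite partial_sum0 add0r; exact: modw_refl.
Qed.

Lemma adic_addN : left_inverse (adic_zero a) (@adic_opp a) (@adic_add a).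
Proof.
move=> x; pose k := maxn (tail (adic_opp x)) (tail x).
have ok : (tail (adic_opp x) <= k)%N by rewrite leq_maxl.
have xk : (tail x <= k)%N by rewrite leq_maxr.
apply: (@adic_modw_inj _ _ k); [exact: add_supp|by move=> i|move=> n].
apply: modw_trans (adic_add_modw ok xk n) _.
apply: modw_trans (modwD (adic_opp_modw xk n) (modw_refl _ _ _)) _.
by rewrite addNr partial_sum0; exact: modw_refl.
Qed.

End PartialSums.

HB.instance Definition _ a := GRing.isZmodule.Build (adic a)
  (@adic_addA a) (@adic_addC a) (@adic_add0 a) (@adic_addN a).

(* the subgroups [{x | x_i = 0 for i < j}] *)
Definition adic_sub (a : radix) (j : int) : set (adic a) :=
  [set x | forall i, i < j -> x i = 0%N].
Arguments adic_sub : clear implicits.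

Section AdicTopology.
Variable a : radix.
Implicit Types (x y z : adic a) (A : set (adic a)).

Lemma adic_sub_le j j' : j <= j' -> adic_sub a j' `<=` adic_sub a j.
Proof. by move=> jj x xj i ij; apply: xj; exact: lt_le_trans ij jj. Qed.

Lemma adic_sub0 j : adic_sub a j 0.
Proof. by []. Qed.

Lemma adic_subD j x y : adic_sub a j x -> adic_sub a j y -> adic_sub a j (x + y).
Proof.
move=> xj yj.
have c0 i : i <= j -> carry x y i = 0%N.
  set k := maxn (tail x) (tail y).
  case: (leP i (- k%:Z)) => ik ij.
    by rewrite (@carry_small _ _ _ k) ?leq_maxl ?leq_maxr.
  have : exists n : nat, i = n%:Z - k%:Z by exists (absz (i + k%:Z)); lia.
  case=> n En; rewrite {i}En in ij ik *.
  elim: n ij {ik} => [|n IH] ij.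
    by rewrite (@carry_small _ _ _ k) ?leq_maxl ?leq_maxr//; lia.
  have E : n.+1%:Z - k%:Z = n%:Z - k%:Z + 1 by lia.
  by rewrite E carryS IH ?xj ?yj ?div0n//; lia.
move=> i ij; change (adic_add_digit x y i = 0%N).
by rewrite /adic_add_digit xj// yj// c0 ?ltW// mod0n.
Qed.

Lemma adic_subN j x : adic_sub a j x -> adic_sub a j (- x).
Proof.
move=> xj i ij; change (adic_opp_digit x i = 0%N); rewrite /adic_opp_digit.
have -> : borrow x i = false.
  by apply/negbTE/asboolPn => -[l li]; rewrite xj//; exact: lt_trans li ij.
by rewrite xj// subn0 modnn.
Qed.

Definition adic_nbhs x : set_system (adic a) :=
  [set A | exists j, forall z, adic_sub a j z -> A (x + z)].

Lemma adic_nbhs_filter x : ProperFilter (adic_nbhs x).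
Proof.
split; first by case=> j /(_ 0 (adic_sub0 (j := j))).
split=> [|A B [i Ai] [j Bj]|A B AB [j Aj]]; first by exists 0.
- exists (Order.max i j) => z zij; split.
    by apply: Ai; apply: adic_sub_le zij; rewrite le_max lexx.
  by apply: Bj; apply: adic_sub_le zij; rewrite le_max lexx orbT.
- by exists j => z /Aj /AB.
Qed.

Lemma adic_nbhs_singleton x A : adic_nbhs x A -> A x.
Proof. by case=> j /(_ 0 (adic_sub0 (j := j))); rewrite addr0. Qed.

Lemma adic_nbhs_nbhs x A : adic_nbhs x A -> adic_nbhs x (adic_nbhs^~ A).
Proof.
case=> j Aj; exists j => z zj; exists j => t tj.
by rewrite -addrA; apply/Aj/adic_subD.
Qed.

End AdicTopology.

HB.instance Definition _ a := hasNbhs.Build (adic a) (@adic_nbhs a).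
HB.instance Definition _ a := Nbhs_isNbhsTopological.Build (adic a)
  (@adic_nbhs_filter a) (@adic_nbhs_singleton a) (@adic_nbhs_nbhs a).

Lemma adic_sub_continuous a : continuous (fun p : adic a * adic a => p.1 - p.2).
Proof.
move=> [x y] A /= [j Aj]; exists ((fun z => adic_sub a j (z - x)), (fun z => adic_sub a j (z - y))).
  by split; exists j => z zj /=; rewrite addrC addKr.
move=> [x' y'] /= [x'j y'j]; have := Aj _ (adic_subD x'j (adic_subN y'j)).
by rewrite /= opprB addrACA [x + _]addrC subrK addKr.
Qed.

HB.instance Definition _ a :=
  PreTopologicalNmodule_isTopologicalZmodule.Build (adic a) (@adic_sub_continuous a).

Section Unit.
Variable a : radix.

Lemma unit_is_adic k : `[< is_adic a (fun i => (i == - k%:Z :> int) : nat) >].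
Proof.
apply: (@is_adicP _ k) => i; last by case: eqP => // ->; rewrite ltxx.
by case: eqP => _; rewrite ?radix_gt0 ?radix_ge2.
Qed.

(* the sequence with entry 1 at position [- k] and 0 elsewhere *)
Definition adic_unit k : adic a := Adic (unit_is_adic k).

Lemma unit_supp k K : (k <= K)%N -> supp_ge K (adic_unit k).
Proof. by move=> kK i iK /=; case: eqP => //; lia. Qed.

Lemma tail_le (x : adic a) K : supp_ge K x -> (tail x <= K)%N.
Proof.
by move=> xK; rewrite /tail; case: ex_minnP => m _; apply; apply/asboolP.
Qed.

Lemma mulrn_modw (x : adic a) K : supp_ge K x -> forall d,
  supp_ge K (x *+ d) /\
  forall n, modw a K n (partial_sum a (x *+ d) K n) (partial_sum a x K n *+ d).
Proof.
move=> xK; elim=> [|d [IH1 IH2]].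
  by split=> // n; rewrite !mulr0n partial_sum0; exact: modw_refl.
have xk := tail_le xK; have dk := tail_le IH1.
rewrite mulrS; split; first exact: add_supp.
move=> n; apply: modw_trans (adic_add_modw xk dk n) _; rewrite mulrS.
exact: modwD (modw_refl _ _ _ _) (IH2 n).
Qed.

Lemma unit_sum k K n : (k <= K)%N ->
  partial_sum a (adic_unit k) K n = if (K - k < n)%N then weight a (- k%:Z) else 0.
Proof.
move=> kK; elim: n => [|n IH]; first by rewrite /partial_sum big_ord0.
rewrite partial_sumS IH /=.
have -> : (n%:Z - K%:Z == - k%:Z) = (K - k == n)%N by apply/eqP/eqP; lia.
rewrite ltnS [in RHS]leq_eqVlt; case: eqP => [E|E] /=; last by rewrite mul0r addr0.
by rewrite -E ltnn add0r mul1r; congr (weight a _); lia.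
Qed.

Lemma unit_carry k : adic_unit k.+1 *+ a (- k.+1%:Z) = adic_unit k.
Proof.
have [s1 s2] := mulrn_modw (unit_supp (leqnn k.+1)) (a (- k.+1%:Z)).
apply: (@adic_modw_inj _ _ _ k.+1) => [//||n]; first exact: unit_supp.
apply: modw_trans (s2 n) _; rewrite !unit_sum// subnn subSnn.
have wS : weight a (- k%:Z) = weight a (- k.+1%:Z) *+ a (- k.+1%:Z).
  by rewrite -mulr_natr -weightS; congr (weight a _); lia.
case: n => [|[|n]] /=; rewrite ?mul0rn; first exact: modw_refl.
  by exists 1; rewrite subr0 mul1r -wS; congr (weight a _); lia.
by rewrite -wS; exact: modw_refl.
Qed.

Lemma unit_dvd k K : (k <= K)%N -> exists d : nat,
  weight a (- k%:Z) = weight a (- K%:Z) *+ d /\ adic_unit k = adic_unit K *+ d.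
Proof.
elim: K => [|K IH]; first by rewrite leqn0 => /eqP ->; exists 1%N.
rewrite leq_eqVlt => /predU1P[->|/IH [d [-> ->]]]; first by exists 1%N.
exists (a (- K.+1%:Z) * d)%N; split; last by rewrite mulrnA unit_carry.
rewrite mulrnA; congr (_ *+ _).
by rewrite -mulr_natr -weightS; congr (weight a _); lia.
Qed.

End Unit.

(* [weight a (- k)] is [1 / (a_{-1} ... a_{-k})] *)
Definition fracN_pred (a : radix) : {pred rat} := fun q =>
  `[< exists2 k : nat, (1 <= k)%N & exists j : int, q = j%:~R * weight a (- k%:Z) >].

Lemma fracN_pred_zmod a : zmod_closed (fracN_pred a).
Proof.
split; first by apply/asboolP; exists 1%N => //; exists 0; rewrite mul0r.
move=> _ _ /asboolP[k k1 [j ->]] /asboolP[k' k'1 [j' ->]]; apply/asboolP.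
pose K := maxn k k'.
have [d [wd _]] := @unit_dvd a k K (leq_maxl _ _).
have [d' [wd' _]] := @unit_dvd a k' K (leq_maxr _ _).
exists K; first by rewrite leq_max k1.
exists (j *+ d - j' *+ d'); rewrite wd wd' rmorphB !rmorphMn mulrBl; congr (_ - _);
  by rewrite mulrnAr mulrnAl.
Qed.

HB.instance Definition _ a :=
  GRing.isZmodClosed.Build rat (fracN_pred a) (fracN_pred_zmod a).

Record fracN (a : radix) := FracN {
  fracN_val :> rat;
  fracNP : fracN_val \in fracN_pred a }.

HB.instance Definition _ a := [isSub for @fracN_val a].
HB.instance Definition _ a := [Choice of fracN a by <:].
HB.instance Definition _ a := [SubChoice_isSubZmodule of fracN a by <:].
HB.instance Definition _ a := Topological.copy (fracN a) (discrete_topology (fracN a)).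

Section Embedding.
Variable a : radix.

Lemma fracN_rep (q : fracN a) : exists kj : nat * int,
  (1 <= kj.1)%N /\ (q : rat) = kj.2%:~R * weight a (- kj.1%:Z).
Proof. by have /asboolP[k k1 [j qE]] := fracNP q; exists (k, j). Qed.

(* [j / (a_{-1} ... a_{-k})] is sent to [j] times the sequence with entry 1 at
   position [- k]; the choice of [k] and [j] is irrelevant ([fracN_embedE]) *)
Definition fracN_embed (q : fracN a) : adic a :=
  let kj := sval (cid (fracN_rep q)) in adic_unit a kj.1 *~ kj.2.

Lemma fracN_embedE (q : fracN a) (k : nat) (j : int) :
  (q : rat) = j%:~R * weight a (- k%:Z) -> fracN_embed q = adic_unit a k *~ j.
Proof.
rewrite /fracN_embed; case: cid => -[k' j'] /= [_ ->] E.
have [d [wd ->]] := @unit_dvd a k (maxn k k') (leq_maxl _ _).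
have [d' [wd' ->]] := @unit_dvd a k' (maxn k k') (leq_maxr _ _).
move: E; rewrite wd wd' !pmulrn !mulrzAr -!mulrzAl -!mulrzA.
move/(mulIf (lt0r_neq0 (weight_gt0 _ _)))/intr_inj => E.
by congr (_ *~ _); lia.
Qed.

Lemma fracN_embed_unit (q : fracN a) (k : nat) :
  (q : rat) = weight a (- k%:Z) -> fracN_embed q = adic_unit a k.
Proof. by move=> E; rewrite (@fracN_embedE _ k 1) ?mulr1z// mul1r. Qed.

Lemma fracN_embedD : {morph fracN_embed : p q / p + q}.
Proof.
move=> p q; have [[k j] /= [_ pE]] := fracN_rep p; have [[k' j'] /= [_ qE]] := fracN_rep q.
have [d [wd ud]] := @unit_dvd a k (maxn k k') (leq_maxl _ _).
have [d' [wd' ud']] := @unit_dvd a k' (maxn k k') (leq_maxr _ _).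
rewrite (fracN_embedE pE) (fracN_embedE qE) ud ud' !pmulrn -!mulrzA -mulrzDr.
apply: fracN_embedE; rewrite /= pE qE wd wd' !pmulrn; rewrite rmorphD !rmorphM/=; ring.
Qed.

Lemma fracN_embedB : {morph fracN_embed : p q / p - q}.
Proof.
move=> p q; apply/(addIr (fracN_embed q)).
by rewrite subrK -fracN_embedD subrK.
Qed.

End Embedding.

HB.instance Definition _ (R : realType) := NormedModule.copy R[i] (R[i])^o.
(* makes the product of two groups with a topology a group with a topology *)
HB.saturate prod.

Section PontryaginDual.
Variables (R : realType) (G : PreTopologicalZmodule.type).

Definition is_character (f : G -> R[i]) : Prop :=
  [/\ continuous f, forall x, `|f x| = 1 & forall x y, f (x + y) = f x * f y].

(* The circle group is the set of complex numbers of modulus 1, so that the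
   group law of the dual, written additively, is pointwise multiplication. *)
Record pontryagin_dual := Character {
  character_fun :> G -> R[i];
  characterP : `[< is_character character_fun >] }.

HB.instance Definition _ := [isSub for character_fun].
HB.instance Definition _ := [Choice of pontryagin_dual by <:].

Implicit Types f g h : pontryagin_dual.

Lemma dualE f g : f =1 g :> (G -> R[i]) -> f = g.
Proof. by move=> /funext fg; apply: val_inj. Qed.

Lemma character_neq0 f x : f x != 0.
Proof. by have /asboolP[_ /(_ x) f1 _] := characterP f; rewrite -normr_eq0 f1 oner_neq0. Qed.

Lemma dual_zero_subproof : `[< is_character (fun=> 1) >].
Proof.
by apply/asboolP; split=> [x|x|x y]; [exact: cvg_cst|rewrite normr1|rewrite mulr1].
Qed.

Lemma dual_add_subproof f g : `[< is_character (fun x => f x * g x) >].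
Proof.
have /asboolP[fc f1 fM] := characterP f; have /asboolP[gc g1 gM] := characterP g.
apply/asboolP; split=> [x|x|x y]; first by apply: cvgM; [exact: fc|exact: gc].
  by rewrite normrM f1 g1 mulr1.
by rewrite fM gM mulrACA.
Qed.

Lemma dual_opp_subproof f : `[< is_character (fun x => (f x)^-1) >].
Proof.
have /asboolP[fc f1 fM] := characterP f.
apply/asboolP; split=> [x|x|x y].
- by apply: cvgV; [exact: character_neq0|exact: fc].
- by rewrite normfV f1 invr1.
- by rewrite fM invfM.
Qed.

Definition dual_zero : pontryagin_dual := Character dual_zero_subproof.
Definition dual_add f g : pontryagin_dual := Character (dual_add_subproof f g).
Definition dual_opp f : pontryagin_dual := Character (dual_opp_subproof f).

Lemma dual_addA : associative dual_add.
Proof. by move=> f g h; apply: dualE => x /=; rewrite mulrA. Qed.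
Lemma dual_addC : commutative dual_add.
Proof. by move=> f g; apply: dualE => x /=; rewrite mulrC. Qed.
Lemma dual_add0 : left_id dual_zero dual_add.
Proof. by move=> f; apply: dualE => x /=; rewrite mul1r. Qed.
Lemma dual_addN : left_inverse dual_zero dual_opp dual_add.
Proof. by move=> f; apply: dualE => x /=; rewrite mulVf ?character_neq0. Qed.

HB.instance Definition _ :=
  GRing.isZmodule.Build pontryagin_dual dual_addA dual_addC dual_add0 dual_addN.

HB.instance Definition _ := Topological.copy pontryagin_dual
  (initial_topology (character_fun : pontryagin_dual -> {compact-open, G -> R[i]})).

Definition annihilator (H : {pred G}) : {pred pontryagin_dual} :=
  fun f => `[< forall x, x \in H -> f x = 1 >].

Lemma annihilator_zmod H : zmod_closed (annihilator H).
Proof.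
split=> [|f g /asboolP fH /asboolP gH]; apply/asboolP => // x xH.
by rewrite [LHS]/= fH// gH// mul1r invr1.
Qed.

HB.instance Definition _ H :=
  GRing.isZmodClosed.Build pontryagin_dual (annihilator H) (annihilator_zmod H).

End PontryaginDual.
Arguments annihilator R {G} H.

Section QuotientGroup.
Variables (G : PreTopologicalZmodule.type) (H : zmodClosed G).

Definition quotient_group : Type := quotient_topology (Quotient.quot H).

HB.instance Definition _ :=
  Topological.copy quotient_group (quotient_topology (Quotient.quot H)).
(* [GRing.Zmodule.copy] would clash with the choice structure of
   [quotient_topology] *)
HB.instance Definition _ := GRing.isZmodule.Build quotient_group
  (@addrA (Quotient.quot H)) (@addrC (Quotient.quot H))
  (@add0r (Quotient.quot H)) (@addNr (Quotient.quot H)).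

Definition quotient_proj (x : G) : quotient_group := (\pi_(Quotient.quot H) x)%qT.

Lemma quotient_projD : {morph quotient_proj : x y / x + y}.
Proof. by move=> x y; exact: (Quotient.pi_add H x y). Qed.

Lemma quotient_proj_eq x y : quotient_proj x = quotient_proj y <-> x - y \in H.
Proof. by rewrite Quotient.idealrBE; split=> [xy|/eqP//]; apply/eqP. Qed.

End QuotientGroup.
Arguments quotient_group {G} H.

Definition topgroup_iso (G H : PreTopologicalZmodule.type) (f : G -> H) : Prop :=
  {morph f : x y / x + y} /\
  exists g : H -> G, [/\ cancel f g, cancel g f, continuous f & continuous g].

Definition diag_embed (R : realType) (a : radix) (q : fracN a) : R * adic a :=
  (ratr (q : rat), fracN_embed q).

Definition diagonalN (R : realType) (a : radix) : {pred (R * adic a)%type} :=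
  fun p => `[< exists q : fracN a, p = diag_embed R q >].

Arguments diagonalN R a : clear implicits.

Lemma diagonalN_zmod (R : realType) a : zmod_closed (diagonalN R a).
Proof.
split.
  apply/asboolP; exists 0; rewrite /diag_embed raddf0.
  by rewrite (@fracN_embedE _ _ 0 0) ?mulr0z// mul0r.
move=> _ _ /asboolP[p ->] /asboolP[q ->]; apply/asboolP; exists (p - q).
by rewrite /diag_embed fracN_embedB raddfB.
Qed.

HB.instance Definition _ (R : realType) a :=
  GRing.isZmodClosed.Build (R * adic a)%type (diagonalN R a) (diagonalN_zmod R a).

(* [x_{-k} / (a_{-1} ... a_{-k}) + ... + x_0 + ... + a_0 ... a_{j-1} x_j] for the
   least [k] such that [x] vanishes below [- k]; a larger [k] only adds zeros *)
Definition truncation (a : radix) (x : adic a) (j : nat) : rat :=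
  partial_sum a x (tail x) (tail x + j).+1.

(* [expi t] is the exponential of [i t] *)
Definition expi (R : realType) (t : R) : R[i] := cos t +i* sin t.

Definition pairing (R : realType) (a : radix)
    (p : R * adic a) (r : R * adic (radix_dual a)) : R[i] :=
  expi (- (2 * pi * (p.1 * r.1) / (a 0)%:R)) *
  lim ((fun j : nat =>
     expi (2 * pi * ratr (truncation p.2 j * truncation r.2 j) / (a 0)%:R : R)) @ \oo).

(* Main.v *)
(* Restriction of characters along the diagonal embedding gives an injection
   psi of dual(R x Omega) / N^perp into dual(N), and the pairing gives a map
   from R x Omega^* to dual(R x Omega); everything reduces to the composite
   omega : R x Omega^* -> dual(N).  Modulo Z, the truncated products
   x^(j) y^(j) / a_0 only depend on x and y modulo high weights, because
   weight a i * weight a^* (1 - i) = a_0; so the pairing is bimultiplicative,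
   and the factor depending on (x, y) is locally constant.  On the generator
   e_k = 1 / (a_{-1} ... a_{-k}) of N,
     omega(v, y)(e_k) = exp(2 i pi (y^(k) - v) / (a^*_0 ... a^*_k)).
   If all these values are 1, then v is the rational number whose image in
   Omega^* is y, so the kernel is N^*.  Conversely, given a character chi of N
   and v such that the formula holds at e_k with y^(k) = 0, the digits
   y_{k+1}, y_{k+2}, ... are found one at a time, each from a root of unity.
   With k = 0 this is surjectivity; with chi close to 1 at e_k and v close to 0
   it is openness, so no compactness argument is needed. *)

Require Import Defs.
From HB Require Import structures.
From mathcomp Require Import all_boot all_order all_algebra.
From mathcomp Require Import complex ring lra zify.
From mathcomp Require Import all_classical all_reals all_analysis.

Set Implicit Arguments.
Unset Strict Implicit.
Unset Printing Implicit Defensive.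

Import Order.TTheory GRing.Theory Num.Theory.
Import numFieldNormedType.Exports.

Local Open Scope classical_set_scope.
Local Open Scope ring_scope.

(** * The circle group *)

Section Circle.
Variable R : realType.
Implicit Types s t : R.
Local Open Scope complex_scope.

Definition circ (t : R) : R[i] := expi (2 * pi * t).

Lemma expiD s t : expi (s + t) = expi s * expi t :> R[i].
Proof.
by rewrite /expi cosD sinD; simpc; congr (_ +i* _); rewrite addrC.
Qed.

Lemma circD s t : circ (s + t) = circ s * circ t.
Proof. by rewrite /circ mulrDr expiD. Qed.

Lemma circ0 : circ 0 = 1.
Proof. by rewrite /circ /expi mulr0 cos0 sin0. Qed.

Lemma norm_circ t : `|circ t| = 1.
Proof. by rewrite normc_def /= cos2Dsin2 sqrtr1. Qed.

Lemma circ_neq0 t : circ t != 0.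
Proof. by rewrite -normr_eq0 norm_circ oner_neq0. Qed.

Lemma circN t : circ (- t) = (circ t)^-1.
Proof.
by apply: (mulIf (circ_neq0 t)); rewrite -circD addNr circ0 mulVf ?circ_neq0.
Qed.

Lemma circMn t n : circ (t *+ n) = circ t ^+ n.
Proof. by elim: n => [|n IH]; rewrite ?circ0// mulrS circD IH exprS. Qed.

Lemma circ1 : circ 1 = 1.
Proof. by rewrite /circ /expi mulr1 mulr_natl cos2pi sin2pi. Qed.

Lemma circ_int (m : int) : circ m%:~R = 1.
Proof.
case: m => n; first by rewrite -pmulrn circMn circ1 expr1n.
by rewrite NegzE mulrNz circN -pmulrn circMn circ1 expr1n invr1.
Qed.

(** Subtracting the floor leaves [s] in [0, 1) with cos(2 pi s) = 1. Injectivity of the cosine on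
    [0, pi] gives s = 0 if s <= 1/2; otherwise, applied to 1 - s, it contradicts s < 1. *)
Lemma circ_eq1 t : circ t = 1 -> exists m : int, t = m%:~R.
Proof.
move=> t1; exists (Num.floor t); set m := Num.floor t.
have pi0 := pi_gt0 R.
have [m0 m1] : m%:~R <= t /\ t < (m + 1)%:~R by rewrite floor_le floorD1_gt.
have : circ (t - m%:~R) = 1 by rewrite circD circN circ_int t1 invr1 mulr1.
have s1 : t - m%:~R < 1 by rewrite ltrBlDl -intrD1.
have s0 : 0 <= t - m%:~R by rewrite subr_ge0.
move: (t - m%:~R) s0 s1 (subrK m%:~R t) => s s0 s1 sE [c1 _].
suff E : s = 0 by rewrite -sE E add0r.
have cos_eq1 u : 0 <= u -> u <= pi -> cos u = 1 -> u = 0 :> R.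
  move=> u0 upi u1; apply: cos_inj; rewrite ?cos0// in_itv /= ?lexx ?u0//.
  exact: ltW.
have [s2|s2] := leP s (1 / 2).
  have /eqP : 2 * pi * s = 0 by apply: cos_eq1 => //; nra.
  by rewrite mulf_eq0 mulf_eq0 pnatr_eq0 (gt_eqF pi0) /= => /eqP.
have : 2 * pi * (1 - s) = 0.
  apply: cos_eq1; [nra|nra|].
  have -> : 2 * pi * (1 - s) = - (2 * pi * s) + pi *+ 2 by ring.
  by rewrite cosD2pi cosN.
by nra.
Qed.

Lemma circ_acos (z : R[i]) : `|z| = 1 -> exists t,
  [/\ 0 <= t <= 1 / 2, cos (2 * pi * t) = complex.Re z & circ t = z \/ circ (- t) = z].
Proof.
case: z => x y z1; have pi0 := pi_gt0 R.
have xy1 : x ^+ 2 + y ^+ 2 = 1.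
  by apply: (@complexI R); rewrite -[x]/(complex.Re (x +i* y)) -[y in LHS]/(complex.Im (x +i* y))
    add_Re2_Im2 z1 expr1n.
have x1 : -1 <= x <= 1 by apply/andP; split; nra.
have xin : x \in `[(-1), 1] by rewrite in_itv.
have pi2 : 2 * pi != 0 :> R by rewrite mulf_neq0 ?gt_eqF.
exists (acos x / (2 * pi)); have tE : 2 * pi * (acos x / (2 * pi)) = acos x.
  by rewrite mulrCA mulfV ?mulr1.
split.
- rewrite divr_ge0 ?acos_ge0 ?mulr_ge0 ?(ltW pi0)//= ler_pdivrMr ?mulr_gt0//.
  by have := acos_lepi x1; lra.
- by rewrite tE acosK.
- rewrite /circ /expi mulrN tE cosN sinN acosK// sin_acos//.
  have -> : 1 - x ^+ 2 = y ^+ 2 by rewrite -xy1 addrC addKr.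
  rewrite sqrtr_sqr; have [y0|/ltW y0] := leP 0 y; [left|right]; first by rewrite ger0_norm.
  by rewrite ler0_norm// opprK.
Qed.

Lemma circ_surj (z : R[i]) : `|z| = 1 -> exists t, circ t = z.
Proof. by case/circ_acos => t [_ _ [tz|tz]]; [exists t|exists (- t)]. Qed.

(** A quantitative form of surjectivity: the cosine decreases on [0, pi], so a real part close to 1
    forces a small argument. Openness of omega rests on this bound. *)
Lemma circ_section (z : R[i]) (e : R) : `|z| = 1 -> 0 < e -> e < 1 / 2 ->
  cos (2 * pi * e) < complex.Re z -> exists2 t, `|t| < e & circ t = z.
Proof.
have pi0 := pi_gt0 R.
move=> /circ_acos[t [/andP[t0 t1] tz ct]] e0 e1; rewrite -tz ltr_cos ?in_itv/=; last 2 first.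
- by apply/andP; split; nra.
- by apply/andP; split; nra.
rewrite ltr_pM2l ?mulr_gt0// => te.
by case: ct => ct; [exists t|exists (- t)]; rewrite // ?normrN ger0_norm.
Qed.

Lemma circ_root (z : R[i]) n : (0 < n)%N -> z ^+ n = 1 -> `|z| = 1 ->
  exists2 d : nat, (d < n)%N & z = circ (d%:R / n%:R).
Proof.
move=> n0 zn /circ_surj[t tz]; rewrite -tz -circMn in zn *.
have nR : n%:R != 0 :> R by rewrite pnatr_eq0 -lt0n.
have [m mE] := circ_eq1 zn.
have nz : n%:Z != 0 by lia.
(* Since t = m / n, only the remainder of [m] modulo [n] matters to [circ t]. *)
exists `|(m %% n)%Z|%N; first by have := @modz_ge0 m n nz; have := @ltz_pmod m n; lia.
have -> : t = m%:~R / n%:R by rewrite -mE -[t *+ n]mulr_natr mulfK.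
rewrite [in LHS](divz_eq m n) intrD intrM mulrDl circD mulfK// circ_int mul1r.
by rewrite -[in LHS](gez0_abs (modz_ge0 m nz)).
Qed.

Lemma real_complex_continuous : continuous (fun x : R => x%:C : R[i]).
Proof.
move=> x; apply/cvgrPdist_lt => e e0.
have eE : (complex.Re e)%:C = e by apply: RRe_real; rewrite gtr0_real.
have e0' : 0 < complex.Re e by rewrite -ltcR eE.
near=> y.
have : `|x - y| < complex.Re e by near: y; exact: cvgr_dist_lt.
rewrite -ltcR eE => /le_lt_trans; apply; rewrite -rmorphB normc_def /=.
by rewrite expr0n addr0 sqrtr_sqr.
Unshelve. all: by end_near. Qed.

Lemma expi_continuous : continuous (@expi R).
Proof.
move=> t; have -> : @expi R = fun t => (cos t)%:C + 'i%C * (sin t)%:C.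
  by apply/funext => s; rewrite [LHS]complexE.
apply: cvgD; last apply: cvgM; first 2 last.
- apply: (continuous_comp (g := fun x : R => x%:C : R[i])); first exact: continuous_sin.
  exact: real_complex_continuous.
- apply: (continuous_comp (g := fun x : R => x%:C : R[i])); first exact: continuous_cos.
  exact: real_complex_continuous.
- exact: cvg_cst.
Qed.

Lemma circ_continuous : continuous circ.
Proof.
move=> t; apply: (continuous_comp (g := @expi R)); last exact: expi_continuous.
by apply: cvgM; [exact: cvg_cst|exact: cvg_id].
Qed.

End Circle.

(** * Rational approximations of adic numbers *)

Section Weights.
Variable a : radix.

Lemma weight_dvd i j : i <= j -> exists d : nat, weight a j = d%:R * weight a i.
Proof.
move=> ij; have -> : j = i + `|j - i|%N by lia.
elim: `|j - i|%N => [|n [d IH]]; first by exists 1%N; rewrite addr0 mul1r.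
exists (d * a (i + n)%R)%N; have -> : i + n.+1%:Z = i + n + 1 by lia.
rewrite weightS IH natrM; ring.
Qed.

(** Raising i by 1 multiplies the first factor by a_i and divides the second by the dual radix at
    -i, which is also a_i. The constant value is read off at i = 0. *)
Lemma weight_dual i : weight a i * weight (radix_dual a) (1 - i) = (a 0)%:R.
Proof.
have step j : weight a (j + 1) * weight (radix_dual a) (1 - (j + 1)) =
    weight a j * weight (radix_dual a) (1 - j).
  have -> : 1 - j = - j + 1 by lia.
  have -> : 1 - (j + 1) = - j by lia.
  by rewrite !weightS /= opprK; ring.
have E (n : nat) : weight a n * weight (radix_dual a) (1 - n%:Z) = (a 0)%:R.
  elim: n => [|n IH]; last first.
    by rewrite -IH -(step n%:Z); have -> : n.+1%:Z = n%:Z + 1 by lia.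
  have -> : 1 - 0%N%:Z = 0 + 1 by lia.
  by rewrite weightS /weight big_ord0 mul1r [X in X * _]big_ord0 mul1r /= oppr0.
have E' (n : nat) : weight a (- n%:Z) * weight (radix_dual a) (1 - - n%:Z) = (a 0)%:R.
  elim: n => [|n IH]; first exact: (E 0%N).
  by rewrite -IH -(step (- n.+1%:Z)); have -> : - n.+1%:Z + 1 = - n%:Z by lia.
by case: i => n; [exact: E|rewrite NegzE; exact: E'].
Qed.

(** Such products become integers after division by a_0, so [circ] does not see them; this is the
    source of all the level conditions on approximations below. *)
Lemma weight_dual_dvd i j : 1 <= i + j ->
  exists d : nat, weight a i * weight (radix_dual a) j = d%:R * (a 0)%:R.
Proof.
move=> ij; have [|d E] := @weight_dvd (1 - j) i; first by lia.
exists d; rewrite E -mulrA; congr (_ * _).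
by rewrite -[X in _ * weight _ X](subKr 1) weight_dual.
Qed.

End Weights.

Section Approximation.
Variable a : radix.
Implicit Types (x y : adic a) (i j : int) (p q : rat).

Lemma partial_sum_shift (f : int -> nat) k l n : supp_ge k f ->
  partial_sum a f (l + k) (l + n) = partial_sum a f k n.
Proof.
move=> fk; rewrite /partial_sum big_split_ord /= [X in X + _]big1 ?add0r => [|m _].
  by apply: eq_bigr => m _; have -> : (l + m)%N%:Z - (l + k)%N%:Z = m%:Z - k%:Z by lia.
by rewrite fk ?mul0r//; have := ltn_ord m; lia.
Qed.

(* [p] is congruent to [\sum_(j < i) x_j * weight a j] modulo [weight a i] *)
Definition approx x i p := exists k n : nat,
  [/\ supp_ge k x, i = n%:Z - k%:Z & modw a k n p (partial_sum a x k n)].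

Lemma approxP x k n p : supp_ge k x ->
  approx x (n%:Z - k%:Z) p -> modw a k n p (partial_sum a x k n).
Proof.
move=> xk [k' [n' [xk' E [m pE]]]]; exists m.
rewrite E -pE; congr (_ - _).
(* Both sums are moved to the common starting position -(k + k'), where they have the same number of
   terms. *)
rewrite -(@partial_sum_shift _ _ k' n xk) -(@partial_sum_shift _ _ k n' xk').
by rewrite addnC; congr (partial_sum _ _ _ _); lia.
Qed.

Lemma approx_partial_sum x k n : supp_ge k x ->
  approx x (n%:Z - k%:Z) (partial_sum a x k n).
Proof. by move=> xk; exists k, n; split=> //; exact: modw_refl. Qed.

Lemma approx_ex x i : exists p, approx x i p.
Proof.
pose k := maxn (tail x) `|i|; pose n := `|(i + k)%R|%N.
have -> : i = n%:Z - k%:Z by lia.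
by exists (partial_sum a x k n); apply/approx_partial_sum/tailP; rewrite leq_maxl.
Qed.

Lemma approxD x y i p q : approx x i p -> approx y i q -> approx (x + y) i (p + q).
Proof.
pose k := maxn `|i| (maxn (tail x) (tail y)); pose n := `|(i + k)%R|%N.
have xk : (tail x <= k)%N by rewrite !leq_max leqnn !orbT.
have yk : (tail y <= k)%N by rewrite !leq_max leqnn !orbT.
have -> : i = n%:Z - k%:Z by lia.
move=> /(approxP (tailP xk)) px /(approxP (tailP yk)) qy; exists k, n; split=> //.
  exact: add_supp.
exact/(modw_trans (modwD px qy))/modw_sym/adic_add_modw.
Qed.

Lemma approxN x i p : approx x i p -> approx (- x) i (- p).
Proof.
pose k := maxn `|i| (tail x); pose n := `|(i + k)%R|%N.
have xk : (tail x <= k)%N by rewrite !leq_max leqnn !orbT.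
have -> : i = n%:Z - k%:Z by lia.
move=> /(approxP (tailP xk)) [m pE]; exists k, n; split=> //; first exact/opp_small/tailP.
apply: modw_trans (modw_sym (adic_opp_modw xk n)).
by exists (- m); rewrite mulrNz mulNr -pE; ring.
Qed.

Lemma approx0 x i : adic_sub a i x -> approx x i 0.
Proof.
move=> xi; pose k := maxn `|i| (tail x); pose n := `|(i + k)%R|%N.
have iE : i = n%:Z - k%:Z by lia.
exists k, n; split=> //; first by apply: tailP; rewrite leq_maxr.
rewrite /partial_sum big1 => [|m _]; first exact: modw_refl.
by rewrite xi ?mul0r// iE; have := ltn_ord m; lia.
Qed.

Lemma approxMz x i p (m : int) : approx x i p -> approx (x *~ m) i (p *~ m).
Proof.
move=> xp.
have xpn (n : nat) : approx (x *+ n) i (p *+ n).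
  by elim: n => [|n IH]; [exact: approx0|rewrite !mulrS; exact: approxD].
by case: m => n; [exact: xpn|apply: approxN; exact: xpn].
Qed.

Lemma approx_uniq x i p q : approx x i p -> approx x i q ->
  exists m : int, p = q + m%:~R * weight a i.
Proof.
case=> k [n [xk -> pE]] /(approxP xk) /modw_sym qE.
by have [m E] := modw_trans pE qE; exists m; rewrite -E addrC subrK.
Qed.

Lemma approx_modw x i p q (m : int) : p = q + m%:~R * weight a i ->
  approx x i q -> approx x i p.
Proof.
move=> pE [k [n [xk iE qx]]]; exists k, n; split=> //; apply: modw_trans qx.
by exists m; rewrite pE iE addrAC subrr add0r.
Qed.

Lemma approx_le x i j p : i <= j -> approx x j p -> approx x i p.
Proof.
move=> ij; have -> : j = i + `|j - i|%N by lia.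
elim: `|j - i|%N => [|n IH]; first by rewrite addr0.
have -> : i + n.+1%:Z = i + n + 1 by lia.
move: (i + n%:Z) IH => {ij}j IH; move=> xp; apply: {i}IH.
pose k := maxn `|j| (tail x); pose n' := `|(j + k)%R|%N.
have xk : supp_ge k x by apply: tailP; rewrite leq_maxr.
have jE : j = n'%:Z - k%:Z by lia.
have j1E : j + 1 = n'.+1%:Z - k%:Z by lia.
move: xp; rewrite j1E => /(approxP xk) [m].
rewrite partial_sumS -j1E -jE weightS => E; exists k, n'; split=> //.
(* The old error is a multiple of a_j times the weight of j; dropping the digit at j adds x_j times
   that weight. *)
exists (m * (a j : int) + x j); rewrite rmorphD rmorphM /= -!pmulrn mulrDl.
by rewrite -jE -[m%:~R * _ * _]mulrA [(a j)%:R * _]mulrC -E; ring.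
Qed.

(** At level -k the rational 0 is already an approximation, and [p] can differ from it only by a
    multiple of that weight. *)
Lemma approx_denom x k i p : supp_ge k x -> - k%:Z <= i -> approx x i p ->
  exists m : int, p = m%:~R * weight a (- k%:Z).
Proof.
move=> xk ki /(approx_le ki) xp.
have [m ->] := approx_uniq xp (approx0 (i := - k%:Z) xk).
by exists m; rewrite add0r.
Qed.

Lemma approx_truncation x (n : nat) i : i <= n.+1%:Z -> approx x i (truncation x n).
Proof.
move=> ni; apply: (approx_le ni).
have -> : n.+1%:Z = (tail x + n).+1%:Z - (tail x)%:Z by lia.
by apply: approx_partial_sum; exact: tailP.
Qed.

Lemma approx_unit k i : approx (adic_unit a k) i (weight a (- k%:Z)).
Proof.
pose l := maxn `|i| k; pose n := `|(i + l)%R|%N.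
apply: (@approx_le _ _ (n + l).+1%:Z); first by lia.
have -> : (n + l).+1%:Z = (n + l + l).+1%:Z - l%:Z by lia.
have kl : (k <= l)%N by rewrite leq_maxr.
have := approx_partial_sum (n + l + l).+1 (@unit_supp a k l kl).
by rewrite unit_sum//; case: ifP => //; lia.
Qed.

(** A single rational works at all levels at once; together with [approx_inj] this recognizes the
    elements of the embedded group. *)
Lemma approx_embed (q : fracN a) i : approx (fracN_embed q) i q.
Proof.
have [[k m] /= [_ qE]] := fracN_rep q.
by rewrite (fracN_embedE qE) qE mulrzl; exact/approxMz/approx_unit.
Qed.

Lemma approx_inj x y : (forall i, exists2 p, approx x i p & approx y i p) -> x = y.
Proof.
move=> E; pose k := maxn (tail x) (tail y).
have xk : supp_ge k x by apply: tailP; rewrite leq_maxl.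
have yk : supp_ge k y by apply: tailP; rewrite leq_maxr.
apply: (adic_modw_inj xk yk) => n; have [p xp yp] := E (n%:Z - k%:Z).
exact: modw_trans (modw_sym (approxP xk xp)) (approxP yk yp).
Qed.

End Approximation.

(** * The pairing *)

Section Pairing.
Variables (R : realType) (a : radix).
Local Notation b := (radix_dual a).
Implicit Types (u v : R) (x : adic a) (y : adic b).

Lemma a0_neq0 (F : numDomainType) : (a 0)%:R != 0 :> F.
Proof. by rewrite pnatr_eq0 -lt0n radix_gt0. Qed.

(** Expanding p r - p' r' gives three cross terms, with weight levels (-k, j), (i, -l) and (i, j).
    Each pair of levels has sum at least 1, so by [weight_dual_dvd] each term is an integer multiple
    of a_0. *)
Lemma circ_approx x y (k l : nat) i j (p p' r r' : rat) :
  supp_ge k x -> supp_ge l y -> l%:Z < i -> k%:Z < j ->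
  approx x i p -> approx x i p' -> approx y j r -> approx y j r' ->
  circ (ratr (p * r) / (a 0)%:R : R) = circ (ratr (p' * r') / (a 0)%:R : R).
Proof.
move=> xk yl li kj xp xp' yr yr'.
have [s p'E] : exists s : int, p' = s%:~R * weight a (- k%:Z).
  by apply: approx_denom xp' => //; lia.
have [t r'E] : exists t : int, r' = t%:~R * weight b (- l%:Z).
  by apply: approx_denom yr' => //; lia.
have [m pE] := approx_uniq xp xp'; have [n rE] := approx_uniq yr yr'.
have [|d dE] := @weight_dual_dvd a (- k%:Z) j; first by lia.
have [|e eE] := @weight_dual_dvd a i (- l%:Z); first by lia.
have [|f fE] := @weight_dual_dvd a i j; first by lia.
have prE : p * r = p' * r' + (s * n * d + m * t * e + m * n * f)%:~R * (a 0)%:R.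
  rewrite !rmorphD !rmorphM /= -!pmulrn !mulrDl.
  rewrite -[_ * d%:R * _]mulrA -dE -[_ * e%:R * _]mulrA -eE -[_ * f%:R * _]mulrA -fE.
  by rewrite pE rE p'E r'E; ring.
rewrite prE rmorphD mulrDl circD [X in _ * circ X](_ : _ = (s * n * d + m * t * e + m * n * f)%:~R).
  by rewrite circ_int mulr1.
by rewrite rmorphM /= ratr_int ratr_nat mulfK ?a0_neq0.
Qed.

(** Truncations are eventually approximations at levels i and j, so the sequence in the limit is
    eventually constant, and any other approximations at these levels give the same value. *)
Lemma pairing_approx u v x y (k l : nat) i j (p r : rat) :
  supp_ge k x -> supp_ge l y -> l%:Z < i -> k%:Z < j ->
  approx x i p -> approx y j r ->
  pairing (u, x) (v, y) = circ ((ratr (p * r) - u * v) / (a 0)%:R).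
Proof.
move=> xk yl li kj xp yr; rewrite /pairing /=.
rewrite mulrBl circD mulrC; congr (_ * _); last first.
  by rewrite /circ mulrN -[in LHS]mulrA.
apply: lim_near_cst; first exact: norm_hausdorff.
near=> n; rewrite -mulrA; apply: (@circ_approx x y k l i j) => //; apply: approx_truncation.
  have : (`|i| <= n)%N by near: n; exact: nbhs_infty_ge.
  by lia.
have : (`|j| <= n)%N by near: n; exact: nbhs_infty_ge.
by lia.
Unshelve. all: by end_near. Qed.

Lemma pairing_circ u v x y : exists t, pairing (u, x) (v, y) = circ t.
Proof.
have [p xp] := approx_ex x (tail y).+1; have [r yr] := approx_ex y (tail x).+1.
eexists; apply: (@pairing_approx _ _ _ _ (tail x) (tail y)) xp yr;
  [exact: tailP|exact: tailP|lia|lia].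
Qed.

Lemma norm_pairing (g : R * adic a) (h : R * adic b) : `|pairing g h| = 1.
Proof. by case: g h => u x [v y]; have [t ->] := pairing_circ u v x y; rewrite norm_circ. Qed.

Lemma pairingDl (g g' : R * adic a) (h : R * adic b) :
  pairing (g + g') h = pairing g h * pairing g' h.
Proof.
case: g g' h => u x [u' x'] [v y].
(* A common support bound lets one approximation of [y] serve all three pairings; approximations of
   [x] and [x'] then simply add. *)
pose k := maxn (tail x) (tail x').
have xk : supp_ge k x by apply: tailP; rewrite leq_maxl.
have xk' : supp_ge k x' by apply: tailP; rewrite leq_maxr.
have xxk : supp_ge k (x + x') by apply: add_supp; rewrite ?leq_maxl ?leq_maxr.
have yl := tailP (leqnn (tail y)).
have [p xp] := approx_ex x (tail y).+1; have [p' xp'] := approx_ex x' (tail y).+1.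
have [r yr] := approx_ex y k.+1.
have li : (tail y)%:Z < (tail y).+1 by lia.
have kj : k%:Z < k.+1 by lia.
rewrite (pairing_approx (u + u') v xxk yl li kj (approxD xp xp') yr).
rewrite (pairing_approx _ _ xk yl li kj xp yr) (pairing_approx _ _ xk' yl li kj xp' yr).
by rewrite -circD; congr circ; rewrite (mulrDl p p') rmorphD; ring.
Qed.

Lemma pairingDr (g : R * adic a) (h h' : R * adic b) :
  pairing g (h + h') = pairing g h * pairing g h'.
Proof.
case: g h h' => u x [v y] [v' y'].
pose l := maxn (tail y) (tail y').
have yl : supp_ge l y by apply: tailP; rewrite leq_maxl.
have yl' : supp_ge l y' by apply: tailP; rewrite leq_maxr.
have yyl : supp_ge l (y + y') by apply: add_supp; rewrite ?leq_maxl ?leq_maxr.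
have xk := tailP (leqnn (tail x)).
have [r yr] := approx_ex y (tail x).+1; have [r' yr'] := approx_ex y' (tail x).+1.
have [p xp] := approx_ex x l.+1.
have li : l%:Z < l.+1 by lia.
have kj : (tail x)%:Z < (tail x).+1 by lia.
rewrite (pairing_approx u (v + v') xk yyl li kj xp (approxD yr yr')).
rewrite (pairing_approx _ _ xk yl li kj xp yr) (pairing_approx _ _ xk yl' li kj xp yr').
by rewrite -circD; congr circ; rewrite (mulrDr p r r') rmorphD; ring.
Qed.

Lemma nbhs_approx x i p : approx x i p ->
  nbhs x [set z | approx z i p].
Proof.
by move=> xp; exists i => z zi; rewrite /= -[p]addr0; apply/approxD/approx0.
Qed.

Lemma nbhs_supp x (k : nat) : supp_ge k x -> nbhs x [set z | supp_ge k z].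
Proof. by move=> xk; exists (- k%:Z) => z zk; exact: adic_subD. Qed.

End Pairing.

(** Near a given point the same rationals [p] and [r] remain valid approximations, so the pairing
    coincides there with a continuous function of the two real coordinates. The dual variable comes
    first so that currying yields a map into the compact-open function space. *)
Lemma pairing_continuous (R : realType) (a : radix) :
  continuous (fun z : (R * adic (radix_dual a)) * (R * adic a) => pairing z.2 z.1).
Proof.
move=> [[v y] [u x]].
have [p xp] := approx_ex x (tail y).+1; have [r yr] := approx_ex y (tail x).+1.
pose f (z : (R * adic (radix_dual a)) * (R * adic a)) : R[i]%C :=
  circ ((ratr (p * r) - z.2.1 * z.1.1) / (a 0)%:R).
have E (v' u' : R) (x' : adic a) (y' : adic (radix_dual a)) :
    supp_ge (tail x) x' -> supp_ge (tail y) y' ->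
    approx x' (tail y).+1 p -> approx y' (tail x).+1 r ->
    pairing (u', x') (v', y') = f ((v', y'), (u', x')).
  move=> xk yl xp' yr'.
  by apply: (@pairing_approx _ _ _ _ _ _ (tail x) (tail y) (tail y).+1 (tail x).+1) => //; lia.
have fc : continuous f.
  move=> z; apply: (@continuous_comp _ _ _ (fun z : (R * adic (radix_dual a)) * (R * adic a) =>
      (ratr (p * r) - z.2.1 * z.1.1) / (a 0)%:R) (@circ R)); last exact: circ_continuous.
  apply: cvgM; last exact: cvg_cst.
  apply: cvgB; first exact: cvg_cst.
  by apply: cvgM; [apply: (cvg_comp _ _ cvg_snd); exact: cvg_fst
                  |apply: (cvg_comp _ _ cvg_fst); exact: cvg_fst].
pose A := [set x' : adic a | supp_ge (tail x) x' /\ approx x' (tail y).+1 p].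
pose B := [set y' : adic (radix_dual a) | supp_ge (tail y) y' /\ approx y' (tail x).+1 r].
have xA : nbhs x A by apply: filterI; [apply/nbhs_supp/tailP|exact: nbhs_approx].
have yB : nbhs y B by apply: filterI; [apply/nbhs_supp/tailP|exact: nbhs_approx].
apply: (@cvg_trans _ (f @ nbhs ((v, y), (u, x)))); last first.
  rewrite (E _ _ _ _ _ _ _ _)//; [exact: fc|exact: tailP|exact: tailP].
apply: near_eq_cvg.
have zA : \forall z \near ((v, y), (u, x)), A z.2.2.
  have : (fun z : (R * adic (radix_dual a)) * (R * adic a) => z.2.2) @ ((v, y), (u, x)) --> x.
    by apply: (cvg_comp _ _ cvg_snd); exact: cvg_snd.
  exact.
have zB : \forall z \near ((v, y), (u, x)), B z.1.2.
  have : (fun z : (R * adic (radix_dual a)) * (R * adic a) => z.1.2) @ ((v, y), (u, x)) --> y.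
    by apply: (cvg_comp _ _ cvg_fst); exact: cvg_snd.
  exact.
by apply: filterS2 zA zB => -[[v' y'] [u' x']] [? ?] [? ?]; apply/esym/E.
Qed.

(** * Characters and the dual topology *)

Section DualTopology.
Variables (R : realType) (G : PreTopologicalZmodule.type).
Implicit Types (f g : pontryagin_dual R G).

Lemma continuous_to_dual (T : topologicalType) (h : T -> pontryagin_dual R G) :
  continuous (fun t => (h t : G -> R[i]%C) : {compact-open, G -> R[i]%C}) -> continuous h.
Proof.
move=> /continuousP hc; apply/continuousP => _ [B oB <-].
exact: hc oB.
Qed.

Lemma character_fun_continuous : continuous
  (fun f => (f : G -> R[i]%C) : {compact-open, G -> R[i]%C}).
Proof. exact: initial_continuous. Qed.

Lemma compact_open_eval_continuous (T U : topologicalType) (x : T) :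
  continuous (fun h : {compact-open, T -> U} => h x).
Proof.
apply/continuousP => A oA; rewrite [X in open X](_ : _ = [set h | h @` [set x] `<=` A]).
  exact/compact_open_open/oA/compact_set1.
by apply/seteqP; split=> h /=; rewrite image_set1 sub1set inE.
Qed.

Lemma dual_eval_continuous x : continuous (fun f => f x).
Proof.
move=> f; apply: (@continuous_comp _ _ _
  (fun f => (f : G -> R[i]%C) : {compact-open, G -> R[i]%C}) (fun h => h x)).
  exact: character_fun_continuous.
exact: compact_open_eval_continuous.
Qed.

(** The image of a compact set under [h] is compact, so subbasic open sets pull back to subbasic
    open sets. *)
Lemma compact_open_precomp_continuous (T T' U : topologicalType) (h : T -> T') :
  continuous h -> continuous
  (fun f : {compact-open, T' -> U} => (f \o h : {compact-open, T -> U})).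
Proof.
move=> hc f; apply/(compact_open_cvgP _ (fmap_filter _ (nbhs_filter f))) => K O cK oO fKO.
have chK : compact (h @` K) by apply: continuous_compact cK; exact: continuous_subspaceT.
have : open_nbhs f [set g | g @` (h @` K) `<=` O].
  by split; [exact: compact_open_open|rewrite /= image_comp].
move/open_nbhs_nbhs; apply: filterS => g /=; by rewrite image_comp.
Qed.

Lemma character1 f : f 0 = 1.
Proof.
have /asboolP[_ _ fD] := characterP f.
by apply: (mulIf (character_neq0 f 0)); rewrite -fD mul1r addr0.
Qed.

Lemma characterD f : {morph f : x y / x + y >-> x * y}.
Proof. by have /asboolP[] := characterP f. Qed.

Lemma characterN f x : f (- x) = (f x)^-1.
Proof.
by apply: (mulIf (character_neq0 f x)); rewrite -characterD addNr character1 mulVf ?character_neq0.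
Qed.

Lemma norm_character f x : `|f x| = 1.
Proof. by have /asboolP[] := characterP f. Qed.

Lemma characterMn f x n : f (x *+ n) = f x ^+ n.
Proof. by elim: n => [|n IH]; [exact: character1|rewrite mulrS characterD IH exprS]. Qed.

Lemma eq_characterMz f g x (m : int) : f x = g x -> f (x *~ m) = g (x *~ m).
Proof.
move=> fg; case: m => n; first by rewrite -!pmulrn !characterMn fg.
by rewrite NegzE !mulrNz !characterN -!pmulrn !characterMn fg.
Qed.

Lemma dual_subE f g x : (f - g) x = f x / g x.
Proof. by []. Qed.

End DualTopology.

(** * Generators of N and the characters they determine *)

Section FracN.
Variable a : radix.

Lemma fracN_unit_subproof k : weight a (- k%:Z) \in fracN_pred a.
Proof.
apply/asboolP; exists k.+1 => //; have [d [-> _]] := @unit_dvd a k k.+1 (leqnSn k).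
by exists d%:Z; rewrite -mulr_natl.
Qed.

Definition fracN_unit k : fracN a := FracN (fracN_unit_subproof k).

Lemma fracN_unit_gen (q : fracN a) K : exists k (m : int), (K <= k)%N /\ q = fracN_unit k *~ m.
Proof.
have [[k m] /= [_ qE]] := fracN_rep q.
have [d [wd _]] := @unit_dvd a k (maxn k K) (leq_maxl _ _).
exists (maxn k K), (m * d); rewrite leq_maxr; split=> //; apply: val_inj.
rewrite raddfMz /= -mulrzl rmorphM /= -mulrA.
by rewrite -[X in _ = _ * X]/(d%:R * _) mulr_natl -wd.
Qed.

Lemma fracN_unitS k : fracN_unit k = fracN_unit k.+1 *+ a (- k.+1%:Z).
Proof.
apply: val_inj; rewrite raddfMn -[RHS]mulr_natr -weightS.
by congr (weight a _); lia.
Qed.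

Lemma fracN_character_eq (R : realType) (f g : pontryagin_dual R (fracN a)) K :
  (forall k, (K <= k)%N -> f (fracN_unit k) = g (fracN_unit k)) -> f = g.
Proof.
move=> fg; apply: dualE => q; have [k [m [Kk ->]]] := fracN_unit_gen q K.
exact/eq_characterMz/fg.
Qed.

End FracN.

(** * Restriction of characters to the diagonal *)

Section Restriction.
Variables (R : realType) (a : radix).
Local Notation b := (radix_dual a).

Lemma pairing_is_character (h : R * adic b) :
  `[< is_character (fun g : R * adic a => pairing g h) >].
Proof.
apply/asboolP; split=> [g|g|g g'].
- exact: ((continuous_curry (@pairing_continuous R a)).2 h).
- exact: norm_pairing g h.
- exact: pairingDl g g' h.
Qed.

Definition pairing_dual (h : R * adic b) : pontryagin_dual R (R * adic a)%type :=
  Character (pairing_is_character h).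

Lemma pairing_dualD : {morph pairing_dual : h h' / h + h'}.
Proof. by move=> h h'; apply: dualE => g; exact: pairingDr. Qed.

Lemma pairing_dual_continuous : continuous pairing_dual.
Proof.
apply: (@continuous_to_dual R (R * adic a)%type _ pairing_dual).
exact: (continuous_curry_fun (@pairing_continuous R a)).
Qed.

Lemma diag_embedD : {morph @diag_embed R a : p q / p + q}.
Proof. by move=> p q; rewrite /diag_embed fracN_embedD raddfD. Qed.

Lemma diag_embed_continuous : continuous (@diag_embed R a).
Proof.
move=> q; apply: (near_cst_continuous (diag_embed R q)).
apply: (@filterS _ (nbhs q) (nbhs_filter q) [set q]) => [_ ->//|].
exact: (@discrete_set1 (discrete_topology (fracN a))).
Qed.

Lemma restrict_is_character (f : pontryagin_dual R (R * adic a)%type) :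
  `[< is_character (fun q : fracN a => f (diag_embed R q)) >].
Proof.
have /asboolP[fc f1 fD] := characterP f.
apply/asboolP; split=> [q|q|p q]; last by rewrite diag_embedD fD.
  by apply: continuous_comp; [exact: diag_embed_continuous|exact: fc].
exact: f1.
Qed.

Definition dual_restrict (f : pontryagin_dual R (R * adic a)%type) :
  pontryagin_dual R (fracN a) := Character (restrict_is_character f).

Lemma dual_restrictD : {morph dual_restrict : f g / f + g}.
Proof. by move=> f g; exact: dualE. Qed.

Lemma dual_restrict_continuous : continuous dual_restrict.
Proof.
apply: (@continuous_to_dual R (fracN a)) => f.
apply: (@continuous_comp (pontryagin_dual R (R * adic a)%type)
  {compact-open, (R * adic a)%type -> R[i]%C} {compact-open, fracN a -> R[i]%C}
  (@character_fun R (R * adic a)%type) (fun h => h \o @diag_embed R a)).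
  exact: character_fun_continuous.
exact: (compact_open_precomp_continuous diag_embed_continuous).
Qed.

(** This makes [psi] well defined on the quotient by the annihilator, and injective. *)
Lemma dual_restrict_eq f g :
  dual_restrict f = dual_restrict g <-> f - g \in annihilator R (diagonalN R a).
Proof.
split=> [fg|/asboolP fg].
  apply/asboolP => _ /asboolP[q ->]; rewrite dual_subE.
  have -> : f (diag_embed R q) = g (diag_embed R q) by rewrite -[LHS]/(dual_restrict f q) fg.
  by rewrite mulfV ?character_neq0.
apply: dualE => q; apply: (mulIf (invr_neq0 (character_neq0 g (diag_embed R q)))).
rewrite mulfV ?character_neq0//; apply: fg; apply/asboolP; by exists q.
Qed.

Lemma pairing_unit (v : R) (y : adic b) k r : approx y k.+1 r ->
  pairing (diag_embed R (fracN_unit a k)) (v, y) =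
  circ ((ratr r - v) / ratr (weight b k.+1)).
Proof.
move=> yr; have xk : supp_ge k (fracN_embed (fracN_unit a k)).
  by rewrite (@fracN_embed_unit a _ k)//; exact: unit_supp.
rewrite (pairing_approx _ _ xk (tailP (leqnn (tail y))) _ _ (approx_embed _ (tail y).+1) yr);
  [|lia|lia].
congr circ; rewrite -[fracN_val _]/(weight a (- k%:Z)) rmorphM -mulrBr.
(* Both coordinates of the generator equal [weight a (- k)], and dividing this by a_0 gives the
   inverse of [weight b k.+1]. *)
have /(congr1 (@ratr R)) := weight_dual a (- k%:Z).
have -> : 1 - - k%:Z = k.+1 by lia.
rewrite rmorphM ratr_nat => <-.
have w0 : ratr (weight a (- k%:Z)) != 0 :> R by rewrite fmorph_eq0 lt0r_neq0// weight_gt0.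
have w1 : ratr (weight b k.+1) != 0 :> R by rewrite fmorph_eq0 lt0r_neq0// weight_gt0.
by rewrite invfM mulrACA mulfV// mul1r mulrC.
Qed.

Lemma pairing_diag (q : fracN a) (s : fracN b) : pairing (diag_embed R q) (diag_embed R s) = 1.
Proof.
set x := fracN_embed q; set y := fracN_embed s.
rewrite (@pairing_approx _ _ _ _ _ _ (tail x) (tail y) (tail y).+1 (tail x).+1 q s);
  [|exact: tailP|exact: tailP|lia|lia|exact: approx_embed|exact: approx_embed].
by rewrite rmorphM subrr mul0r circ0.
Qed.

(** Triviality at the k-th generator says that [v] is itself a rational approximating [y] at level k
    + 1. As [v] does not depend on k, this one rational has image [y]. *)
Lemma pairing_kernel (h : R * adic b) :
  (forall q : fracN a, pairing (diag_embed R q) h = 1) -> h \in diagonalN R b.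
Proof.
case: h => v y h1.
have E k : exists r, v = ratr r /\ approx y k.+1 r.
  have [r yr] := approx_ex y k.+1.
  have := h1 (fracN_unit a k); rewrite (pairing_unit v yr) => /circ_eq1[m mE].
  have w0 : ratr (weight b k.+1) != 0 :> R by rewrite fmorph_eq0 lt0r_neq0// weight_gt0.
  exists (r - m%:~R * weight b k.+1); split; last first.
    by apply: (approx_modw (m := - m) _ yr); rewrite mulrNz mulNr.
  have := congr1 (fun t => t * ratr (weight b k.+1)) mE.
  by rewrite mulfVK// rmorphB rmorphM rmorph_int => E; rewrite -[X in _ - X]E subKr.
have [s [vs ys]] := E 0%N.
have sN : s \in fracN_pred b.
  (* The successor ensures the exponent at least 1 demanded by [fracN_pred]. *)
  have yl : supp_ge (tail y).+1 y by apply: tailP.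
  have [|m sE] := approx_denom yl _ ys; first by lia.
  by apply/asboolP; exists (tail y).+1 => //; exists m.
apply/asboolP; exists (FracN sN); rewrite /diag_embed /= -vs; congr (_, _).
apply: approx_inj => i; exists s; last exact: approx_embed.
have [r [vr yr]] := E `|i|%N; have -> : s = r.
  by apply: (fmorph_inj (@ratr R)); exact: etrans (esym vs) vr.
by apply: approx_le yr; lia.
Qed.

Lemma dual_restrict_pairing_eq h h' :
  dual_restrict (pairing_dual h) = dual_restrict (pairing_dual h') <->
  h - h' \in diagonalN R b.
Proof.
rewrite dual_restrict_eq.
have -> : pairing_dual h - pairing_dual h' = pairing_dual (h - h').
  by apply/eqP; rewrite subr_eq -pairing_dualD subrK.
split=> [/asboolP hh|/asboolP[s hh]].
  by apply: pairing_kernel => q; apply: hh; apply/asboolP; exists q.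
by apply/asboolP => _ /asboolP[q ->]; rewrite hh; exact: pairing_diag.
Qed.

End Restriction.

(** * Lifting characters of [N] *)

Section Lifting.
Variables (R : realType) (a : radix).
Local Notation b := (radix_dual a).

Lemma ratr_weight_gt0 i : 0 < ratr (weight b i) :> R.
Proof. by rewrite ltr0q weight_gt0. Qed.

(** The k-th generator is n times the next one, so the value of [chi] there and the value [c]
    predicted without a new digit have equal n-th powers. Their quotient is an n-th root of unity,
    whose exponent is the digit. *)
Lemma character_next_digit (chi : pontryagin_dual R (fracN a)) (v : R) k (r : rat) :
  chi (fracN_unit a k) = circ ((ratr r - v) / ratr (weight b k.+1)) ->
  exists2 d : nat, (d < b k.+1)%N & chi (fracN_unit a k.+1) =
    circ ((ratr (r + d%:R * weight b k.+1) - v) / ratr (weight b k.+2)).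
Proof.
rewrite fracN_unitS characterMn -[a _]/(b k.+1); set n := b k.+1 => chi_k.
have n0 : (0 < n)%N by exact: radix_gt0.
have nR : n%:R != 0 :> R by rewrite pnatr_eq0 -lt0n.
set W := ratr (weight b k.+1) in chi_k *; have W0 : W != 0 by rewrite lt0r_neq0 ?ratr_weight_gt0.
have WS : ratr (weight b k.+2) = W * n%:R.
  have -> : k.+2%:Z = k.+1%:Z + 1 by lia.
  by rewrite weightS rmorphM rmorph_nat.
pose c := circ ((ratr r - v) / ratr (weight b k.+2)).
have cn : c ^+ n = circ ((ratr r - v) / W).
  by rewrite -circMn; congr circ; rewrite WS -mulr_natr; field; apply/andP.
have [||d dn dE] := @circ_root R (chi (fracN_unit a k.+1) / c) n n0.
- by rewrite expr_div_n chi_k cn mulfV ?circ_neq0.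
- by rewrite normf_div norm_character norm_circ divr1.
exists d => //; rewrite -[LHS](divfK (circ_neq0 _ : c != 0)) dE -circD; congr circ.
have -> : ratr (r + d%:R * weight b k.+1) = ratr r + d%:R * W.
  by rewrite rmorphD rmorphM rmorph_nat.
by rewrite WS; field; apply/andP.
Qed.

Lemma character_lift (chi : pontryagin_dual R (fracN a)) (v : R) k :
  chi (fracN_unit a k) = circ (- v / ratr (weight b k.+1)) ->
  exists2 y, adic_sub b k.+1 y & dual_restrict (pairing_dual (v, y)) = chi.
Proof.
move=> chi_k.
(* The rational [r] plays the partial sum of the sought [y] through position k + n. *)
pose good n r := chi (fracN_unit a (k + n)) = circ ((ratr r - v) / ratr (weight b (k + n).+1)).
have /choice[D DP] : forall nr : nat * rat, exists d : nat, good nr.1 nr.2 ->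
    (d < b (k + nr.1).+1)%N /\ good nr.1.+1 (nr.2 + d%:R * weight b (k + nr.1).+1).
  (* The digit 0 is a dummy for pairs that are not good; [rP] shows that the recursion never meets
     one. *)
  move=> [n r] /=; have [g|ng] := pselect (good n r); last by exists 0%N.
  by have [d dn dE] := character_next_digit g; exists d => _; split; rewrite // /good addnS.
pose fix r n : rat := if n is m.+1 then r m + (D (m, r m))%:R * weight b (k + m).+1 else 0.
have rP n : good n (r n).
  elim: n => [|n IH]; first by rewrite /good addn0 raddf0 sub0r.
  by have [] := DP (n, r n) IH.
(* The digit chosen at stage n sits at position k + 1 + n; all lower positions are 0. *)
pose f (i : int) := if i is Posz m then
  (if (k < m)%N then D ((m - k.+1)%N, r (m - k.+1)%N) else 0%N) else 0%N.
have f0 (i : int) : i < k.+1 -> f i = 0%N.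
  by case: i => m //= mk; rewrite ltnNge -ltnS ifN// negbK.
have fb i : (f i < b i)%N.
  case: i => m; rewrite /f; last exact: radix_gt0.
  case: ifP => km; last exact: radix_gt0.
  have [+ _] := DP ((m - k.+1)%N, r (m - k.+1)%N) (rP _).
  by have -> : (k + (m - k.+1)%N).+1 = m by lia.
have fsupp : supp_ge 0 f by move=> i i0; apply: f0; lia.
pose y : adic b := Adic (is_adicP fb fsupp).
have fr n : partial_sum b f 0 (k + n).+1 = r n.
  elim: n => [|n IH].
    by rewrite addn0 /partial_sum big1// => m _; rewrite f0 ?mul0r//; have := ltn_ord m; lia.
  rewrite addnS partial_sumS IH subr0 /= ltnS leq_addr.
  by have -> : ((k + n).+1 - k.+1)%N = n by lia.
exists y; first by move=> i /f0.
apply: (@fracN_character_eq a R _ _ k) => m km; have -> : m = (k + (m - k))%N by lia.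
rewrite rP; apply: pairing_unit; rewrite -fr.
rewrite -[X in approx _ X](subr0 _); exact: (@approx_partial_sum b y 0).
Qed.

Lemma character_surj (chi : pontryagin_dual R (fracN a)) :
  exists h, dual_restrict (pairing_dual h) = chi.
Proof.
have [t tE] := circ_surj (norm_character chi (fracN_unit a 0)).
(* Chosen so that the hypothesis of [character_lift] holds for k = 0. *)
pose v := - t * ratr (weight b 1).
have [|y _ E] := @character_lift chi v 0; last by exists (v, y).
by rewrite -tE /v !mulNr opprK mulfK// lt0r_neq0// ratr_weight_gt0.
Qed.

(** Openness of omega: closeness at one generator suffices. The difference of the two characters is
    lifted to a pair with small real part and all digits up to position k zero, which is then added
    to [h]. *)
Lemma character_lift_near (h : R * adic b) (A : set (R * adic b)) : nbhs h A ->
  \forall chi \near dual_restrict (pairing_dual h),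
    exists2 h', A h' & dual_restrict (pairing_dual h') = chi.
Proof.
case: h => v y [[A1 A2] [/= vA1 [j yA2]] A12].
have /nbhs_ballP[e /= e0 eA1] := vA1.
pose k := `|j|%N; pose W : R := ratr (weight b k.+1).
have W0 : 0 < W by exact: ratr_weight_gt0.
(* The bound 1/4 keeps [d] below 1/2 for [circ_section]; the bound e / W makes the real correction t
   W smaller than [e]. *)
pose d := Num.min (1 / 4) (e / W).
have d0 : 0 < d by rewrite lt_min; apply/andP; split; apply: divr_gt0.
have d1 : d < 1 / 2 by rewrite gt_min; apply/orP; left; lra.
have c1 : 0 < 1 - cos (2 * pi * d).
  rewrite subr_gt0 -[ltRHS]cos0 ltr_cos ?in_itv/= ?lexx ?pi_ge0//.
    by rewrite !mulr_gt0 ?pi_gt0.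
  by have := pi_gt0 R; nra.
pose chi0 := dual_restrict (pairing_dual (v, y)).
have ev : (fun chi : pontryagin_dual R (fracN a) => chi (fracN_unit a k)) @ chi0 -->
    chi0 (fracN_unit a k) by exact: dual_eval_continuous.
have c1' : 0 < (1 - cos (2 * pi * d))%:C%C by rewrite -[0]/(0%:C%C) ltcR.
have /cvgrPdist_lt/(_ _ c1') := ev; apply: filterS => chi /= near_chi.
pose z := (chi - chi0) (fracN_unit a k).
have z1 : `|z| = 1 by exact: norm_character.
have zd : cos (2 * pi * d) < complex.Re z.
  have : `|1 - z| < (1 - cos (2 * pi * d))%:C%C.
    have -> : 1 - z = (chi0 (fracN_unit a k) - chi (fracN_unit a k)) / chi0 (fracN_unit a k).
      by rewrite mulrBl divff ?character_neq0.
    by rewrite normf_div norm_character divr1.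
  move/(le_lt_trans (normc_ge_Re _)); rewrite ltcR raddfB /=.
  by move/(le_lt_trans (ler_norm _)); rewrite ltrD2l ltrN2.
have [t td tz] := circ_section z1 d0 d1 zd.
have [|w wk wE] := @character_lift (chi - chi0) (- t * W) k.
  by rewrite -/z -tz -/W !mulNr opprK mulfK ?lt0r_neq0.
exists (v - t * W, y + w); last first.
  have -> : (v - t * W, y + w) = (v, y) + (- t * W, w) by rewrite -mulNr.
  by rewrite pairing_dualD dual_restrictD wE addrC subrK.
apply: A12; split=> /=.
  apply: eA1; rewrite /ball /= opprB addrCA subrr addr0 normrM (gtr0_norm W0).
  by rewrite -ltr_pdivlMr// (lt_le_trans td)// ge_min lexx orbT.
by apply: yA2; apply: adic_sub_le wk; lia.
Qed.

End Lifting.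

(** * Assembling the two isomorphisms *)

Theorem theorem3p3 (R : realType) (a : radix) :
  exists (phi : quotient_group (diagonalN R (radix_dual a)) ->
                quotient_group (annihilator R (diagonalN R a)))
         (psi : quotient_group (annihilator R (diagonalN R a)) ->
                pontryagin_dual R (fracN a)),
  [/\ topgroup_iso phi, topgroup_iso psi &
      forall (v : R) (y : adic (radix_dual a)) (q : fracN a),
        psi (phi (quotient_proj (diagonalN R (radix_dual a)) (v, y))) q =
        pairing (diag_embed R q) (v, y)].
Proof.
pose Phi := @pairing_dual R a; pose res := @dual_restrict R a.
pose HN := diagonalN R (radix_dual a); pose HA := annihilator R (diagonalN R a).
pose pN := quotient_proj HN; pose pA := quotient_proj HA.
have /choice[W WK] : forall chi, exists h, res (Phi h) = chi by exact: character_surj.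
pose phi (c : quotient_group HN) := pA (Phi (repr c)).
pose psi (c : quotient_group HA) := res (repr c).
(* The choice [W] need not be continuous, but its class modulo the kernel is independent of the
   choice. *)
pose omega_inv chi := pN (W chi).
have pN_repr (c : quotient_group HN) : pN (repr c) = c by exact: reprK.
have pA_repr (c : quotient_group HA) : pA (repr c) = c by exact: reprK.
have psiE f : psi (pA f) = res f.
  apply/dual_restrict_eq/(quotient_proj_eq HA); exact: pA_repr.
have pN_eq h h' : pN h = pN h' <-> res (Phi h) = res (Phi h').
  by rewrite dual_restrict_pairing_eq; exact: quotient_proj_eq.
have phiE h : phi (pN h) = pA (Phi h).
  apply/(quotient_proj_eq HA)/dual_restrict_eq/pN_eq; exact: pN_repr.
have psi_inj c c' : psi c = psi c' -> c = c'.
  rewrite -[c]pA_repr -[c']pA_repr !psiE => /dual_restrict_eq E.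
  exact/(quotient_proj_eq HA).
have phiD : {morph phi : c c' / c + c'}.
  move=> c c'; rewrite -[c]pN_repr -[c']pN_repr -quotient_projD !phiE.
  by rewrite -quotient_projD -pairing_dualD.
have psiD : {morph psi : c c' / c + c'}.
  move=> c c'; rewrite -[c]pA_repr -[c']pA_repr -quotient_projD !psiE.
  exact: dual_restrictD.
have phi_cont : continuous phi.
  apply/quotient_continuous.
  have -> : phi \o \pi_(quotient_topology (Quotient.quot HN))%qT = pA \o Phi.
    by apply/funext => h; exact: phiE.
  move=> h; apply: continuous_comp; first exact: pairing_dual_continuous.
  exact: pi_continuous.
have psi_cont : continuous psi.
  apply/quotient_continuous.
  have -> : psi \o \pi_(quotient_topology (Quotient.quot HA))%qT = res.
    by apply/funext => f; exact: psiE.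
  exact: dual_restrict_continuous.
have omega_inv_cont : continuous omega_inv.
  move=> chi U nU.
  have : nbhs (W chi) (pN @^-1` U) by apply: (@pi_continuous _ (Quotient.quot HN)).
  (* A nearby character has some lift inside the open preimage, and [W chi'] lies in the same class
     as that lift. *)
  move/character_lift_near; rewrite -/(Phi _) -/(res _) WK; apply: filterS => chi' [h Uh hE].
  by rewrite /omega_inv/=; have -> : pN (W chi') = pN h by apply/pN_eq; rewrite WK.
exists phi, psi; split.
(* As omega = psi o phi has a continuous inverse, each factor is inverted by composing that inverse
   with the other factor. *)
- split=> //; exists (omega_inv \o psi); split=> //.
  + move=> c; rewrite -[c]pN_repr phiE /= psiE; apply/pN_eq; exact: WK.
  + by move=> c; apply: psi_inj; rewrite /= phiE psiE WK.
  + by move=> c; apply: continuous_comp; [exact: psi_cont|exact: omega_inv_cont].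
- split=> //; exists (phi \o omega_inv); split=> //.
  + by move=> c; apply: psi_inj; rewrite /= phiE psiE WK.
  + by move=> chi; rewrite /= phiE psiE WK.
  + by move=> c; apply: continuous_comp; [exact: omega_inv_cont|exact: phi_cont].
- by move=> v y q; rewrite phiE psiE.
Qed.
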